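(* Let $F = F(x,y)$ be the free group on $x$ and $y$, and let $X, Y$ be integers. There exists a primitive element $p$ in $F$ with exponent sum pair $(X,Y)$ if and only if $X$ and $Y$ are relatively prime.
   Context: An element of $F$ is primitive if it is the image of $x$ under some automorphism of $F$. The exponent sum pair of $w \in F$ is the pair of integers $(X,Y)$, where $X$ is the exponent sum of $x$ in $w$ and $Y$ is the exponent sum of $y$ in $w$. *)

(* Defs.v *)
From HB Require Import structures.
From mathcomp Require Import all_boot all_order all_algebra.

Set Implicit Arguments.
Unset Strict Implicit.
Unset Printing Implicit Defensive.

Import GRing.Theory.

Section FreeGroup.

Variable T : choiceType.

(* The letter (t, false) stands for t and (t, true) for its formal inverse. *)
Definition letter : Type := (T * bool)%type.

Definition inv_letter (a : letter) : letter := (a.1, ~~ a.2).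

Definition reduced (w : seq letter) : bool :=
  sorted (fun a b => b != inv_letter a) w.

Definition reduced_cons (a : letter) (w : seq letter) : seq letter :=
  if w is b :: w' then if b == inv_letter a then w' else a :: w else [:: a].

Definition reduce (w : seq letter) : seq letter := foldr reduced_cons [::] w.

Definition inv_word (w : seq letter) : seq letter := rev (map inv_letter w).

Lemma inv_letterK : involutive inv_letter.
Proof. by case=> t b; rewrite /inv_letter /= negbK. Qed.

Lemma inv_wordK : involutive inv_word.
Proof.
move=> w; rewrite /inv_word map_rev revK -map_comp -[RHS]map_id.
by apply: eq_map => a; rewrite /= inv_letterK.
Qed.

Lemma reduced_behead a w : reduced (a :: w) -> reduced w.
Proof. exact: path_sorted. Qed.

Lemma reduced_cons_reduced a w : reduced w -> reduced (reduced_cons a w).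
Proof.
case: w => [//|b w] red_w; rewrite /reduced_cons.
by case: ifP => [_|neq]; [exact: reduced_behead red_w | rewrite /= neq].
Qed.

Lemma reduce_reduced w : reduced (reduce w).
Proof. by elim: w => //= a w; exact: reduced_cons_reduced. Qed.

Lemma reduce_id w : reduced w -> reduce w = w.
Proof.
elim: w => //= a w IHw red_w; rewrite IHw ?(reduced_behead red_w) //.
by case: w red_w {IHw} => //= b w /andP[/negPf->].
Qed.

Lemma reduced_consK a w :
  reduced w -> reduced_cons a (reduced_cons (inv_letter a) w) = w.
Proof.
case: w => [|b w] red_w; first by rewrite /= eqxx.
rewrite {2}/reduced_cons inv_letterK; case: eqP => [eq_ba|_]; last first.
  by rewrite /= eqxx.
by case: w red_w => [|c w]; rewrite eq_ba //= => /andP[/negPf->].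
Qed.

Lemma reduce_cat_l s t : reduce (reduce s ++ t) = reduce (s ++ t).
Proof.
elim: s => //= a s <-; case: (reduce s) => [//|b w] /=.
by case: eqP => //= ->; rewrite reduced_consK ?reduce_reduced.
Qed.

Lemma reduce_cat_r s t : reduce (s ++ reduce t) = reduce (s ++ t).
Proof.
by elim: s => /= [|a s -> //]; rewrite reduce_id ?reduce_reduced.
Qed.

Lemma reduce_inv_r w : reduce (w ++ inv_word w) = [::].
Proof.
elim: w => //= a w IHw; rewrite /inv_word map_cons rev_cons -cats1 catA.
by rewrite -reduce_cat_l IHw /= eqxx.
Qed.

Lemma reduced_inv_word w : reduced w -> reduced (inv_word w).
Proof.
rewrite /reduced /inv_word rev_sorted sorted_map; apply: sub_sorted => a b /=.
by apply: contra => /eqP /(can_inj inv_letterK) ->; rewrite inv_letterK.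
Qed.

Record free_group := FreeGroup { word : seq letter; _ : reduced word }.

HB.instance Definition _ := [isSub for word].
HB.instance Definition _ := [Choice of free_group by <:].

Lemma word_reduced (u : free_group) : reduced (word u).
Proof. exact: valP. Qed.

Definition free_group_of (w : seq letter) : free_group :=
  FreeGroup (reduce_reduced w).

Definition fg_one : free_group := free_group_of [::].
Definition fg_mul (u v : free_group) : free_group :=
  free_group_of (word u ++ word v).
Definition fg_inv (u : free_group) : free_group :=
  FreeGroup (reduced_inv_word (word_reduced u)).

Lemma fg_mulA : associative fg_mul.
Proof.
by move=> u v w; apply: val_inj; rewrite /= reduce_cat_l reduce_cat_r catA.
Qed.

Lemma fg_mul1 : left_id fg_one fg_mul.
Proof. by move=> u; apply: val_inj; rewrite /= reduce_id ?word_reduced. Qed.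

Lemma fg_mulr1 : right_id fg_one fg_mul.
Proof.
by move=> u; apply: val_inj; rewrite /= cats0 reduce_id ?word_reduced.
Qed.

Lemma fg_mulV : right_inverse fg_one fg_inv fg_mul.
Proof. by move=> u; apply: val_inj; exact: reduce_inv_r. Qed.

Lemma fg_mulVl : left_inverse fg_one fg_inv fg_mul.
Proof.
move=> u; apply: val_inj => /=.
by rewrite -[X in _ ++ X]inv_wordK reduce_inv_r.
Qed.

HB.instance Definition _ :=
  isGroup.Build free_group fg_mulA fg_mul1 fg_mulr1 fg_mulVl fg_mulV.

Definition gen (t : T) : free_group := free_group_of [:: (t, false)].

Definition exp_sum (t : T) (w : free_group) : int :=
  (\sum_(a <- word w | a.1 == t) (if a.2 then -1 else 1))%R.

Section UniversalProperty.

Variables (H : groupType) (g : T -> H).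

Local Open Scope group_scope.

Definition letter_val (a : letter) : H := if a.2 then (g a.1)^-1 else g a.1.

Definition fg_lift (u : free_group) : H := \prod_(a <- word u) letter_val a.

Lemma letter_valV a : letter_val (inv_letter a) = (letter_val a)^-1.
Proof. by case: a => t [] //=; rewrite /letter_val /= invgK. Qed.

Lemma prod_reduce w :
  \prod_(a <- reduce w) letter_val a = \prod_(a <- w) letter_val a.
Proof.
elim: w => [|a w IHw] /=; first by rewrite big_nil.
rewrite [RHS]big_cons -IHw {IHw}.
case: (reduce w) => [|b w'] /=; first by rewrite big_cons.
case: eqP => [->|_]; last by rewrite big_cons.
by rewrite big_cons letter_valV mulVKg.
Qed.

Lemma fg_liftM : {morph fg_lift : u v / u * v}.
Proof. by move=> u v; rewrite /fg_lift prod_reduce big_cat. Qed.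

HB.instance Definition _ := isMultiplicative.Build free_group H fg_lift fg_liftM.

Lemma fg_lift_gen t : fg_lift (gen t) = g t.
Proof. by rewrite /fg_lift big_seq1. Qed.

Lemma fg_lift_unique (f : {multiplicative free_group -> H}) :
  (forall t, f (gen t) = g t) -> f =1 fg_lift.
Proof.
move=> f_gen; have f1 : f 1 = 1.
  by apply: (mulgI (f 1)); rewrite -gmulfM !mulg1.
have f_letter a : f (free_group_of [:: a]) = letter_val a.
  case: a => t []; last exact: f_gen.
  apply: (mulgI (f (gen t))); rewrite -gmulfM /letter_val /= f_gen mulgV -f1.
  by congr (f _); apply: val_inj; rewrite /= /inv_letter /= eqxx.
case=> w red_w; elim: w red_w => [|a w IHw] red_aw.
  by rewrite /fg_lift big_nil -f1; congr (f _); apply: val_inj.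
have red_w := reduced_behead red_aw.
rewrite /fg_lift big_cons -[X in _ * X](IHw red_w) -f_letter -gmulfM.
by congr (f _); apply: val_inj; exact/esym/(reduce_id red_aw).
Qed.

End UniversalProperty.

End FreeGroup.

(* The free group on x and y, with the basis indexed by bool. *)
Definition F2 : groupType := free_group bool.
Definition x : F2 := gen false.
Definition y : F2 := gen true.

Definition exp_sum_pair (w : F2) : int * int :=
  (exp_sum false w, exp_sum true w).

(* A multiplicative map between groups preserves 1 and inverses, so the
   automorphisms of F2 are its bijective multiplicative self-maps. *)
Definition primitive (p : F2) : Prop :=
  exists f : {multiplicative F2 -> F2}, bijective f /\ f x = p.

(* Main.v *)
(* Exponent sums are additive, so an endomorphism of F2 acts on exponent sum
   pairs through an integer matrix, and an automorphism acts through an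
   invertible one: the first column of such a matrix is a coprime pair.
   Conversely, x |-> xy, the exchange of x and y, and the inversion of x act on
   pairs by (X, Y) |-> (X, X + Y), (Y, X) and (- X, Y), and the Euclidean
   algorithm carries (1, 0), the pair of x, to any coprime pair. *)

Require Import Defs.
From HB Require Import structures.
From mathcomp Require Import all_boot all_order all_algebra.
From mathcomp Require Import zify ring.

Import GRing.Theory.

Section ExponentSum.

Variable T : choiceType.

Implicit Types (t : T) (u v : free_group T).

Local Open Scope ring_scope.

Let letter_exp t (a : letter T) : int :=
  if a.1 == t then (if a.2 then -1 else 1) else 0.

Lemma exp_sumE t u : exp_sum t u = \sum_(a <- word u) letter_exp t a.
Proof. exact: big_mkcond. Qed.

(** Free reduction only deletes adjacent pairs of mutually inverse letters, whose contributions are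
    opposite. *)
Lemma sum_letter_exp_reduce t w :
  \sum_(a <- reduce w) letter_exp t a = \sum_(a <- w) letter_exp t a.
Proof.
elim: w => [|a w IHw] //=; rewrite [RHS]big_cons -{}IHw.
case: (reduce w) => [|b w'] /=; first by rewrite big_cons.
case: eqP => [->|_]; last by rewrite big_cons.
rewrite big_cons addrA /letter_exp /=.
by case: eqP => _; case: a.2 => //=; rewrite ?addNr ?subrr !add0r.
Qed.

Lemma exp_sumM t u v : exp_sum t (u * v)%g = exp_sum t u + exp_sum t v.
Proof. by rewrite !exp_sumE sum_letter_exp_reduce big_cat. Qed.

Lemma exp_sum1 t : exp_sum t 1%g = 0.
Proof. by rewrite exp_sumE big_nil. Qed.

Lemma exp_sumV t u : exp_sum t u^-1%g = - exp_sum t u.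
Proof. by apply/eqP; rewrite -addr_eq0 -exp_sumM mulVg exp_sum1. Qed.

Lemma exp_sum_gen t t' : exp_sum t (gen t') = (t' == t)%:R.
Proof. by rewrite exp_sumE big_seq1 /letter_exp /=; case: eqP. Qed.

End ExponentSum.

Lemma multiplicativeV (G H : groupType) (f : {multiplicative G -> H}) u :
  (f u^-1 = (f u)^-1)%g.
Proof.
have f1 : f 1%g = 1%g by apply: (mulgI (f 1%g)); rewrite -gmulfM !mulg1.
by apply: (mulgI (f u)); rewrite -gmulfM !mulgV.
Qed.

(** By uniqueness of the lift, [f] and [idfun] both equal the lift of [gen]. *)
Lemma multiplicative_id_gen (T : choiceType)
    (f : {multiplicative free_group T -> free_group T}) :
  (forall t, f (gen t) = gen t) -> f =1 id.
Proof.
move=> f_gen u; rewrite (fg_lift_unique f_gen).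
by rewrite -(@fg_lift_unique _ _ _ idfun).
Qed.

(** The matrix action on pairs: [f w] is the product of the images of the letters of [w], and each
    image contributes plus or minus the exponent sum of [f x] or [f y]. *)
Lemma exp_sum_morph t (f : {multiplicative F2 -> F2}) w :
  exp_sum t (f w) = (exp_sum false w * exp_sum t (f x)
                     + exp_sum true w * exp_sum t (f y))%R.
Proof.
rewrite (@fg_lift_unique _ _ (fun b => f (gen b))) // /fg_lift.
rewrite [exp_sum false w]exp_sumE [exp_sum true w]exp_sumE.
elim: (word w) => [|[b e] s IHs]; first by rewrite !big_nil exp_sum1 !mul0r.
rewrite !big_cons exp_sumM {}IHs /letter_val /=.
by case: b; case: e; rewrite ?exp_sumV /= /x /y; ring.
Qed.

Definition primitive_pair (X Y : int) : Prop :=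
  exists p : F2, primitive p /\ exp_sum_pair p = (X, Y).

Definition extend (u v : F2) : {multiplicative F2 -> F2} :=
  @fg_lift bool F2 (fun b => if b then v else u).

Lemma extend_x u v : extend u v x = u. Proof. exact: fg_lift_gen. Qed.
Lemma extend_y u v : extend u v y = v. Proof. exact: fg_lift_gen. Qed.

Lemma extendK u v u' v' :
  extend u v u' = x -> extend u v v' = y -> cancel (extend u' v') (extend u v).
Proof.
move=> ux vy; apply: (@multiplicative_id_gen _ (extend u v \o extend u' v')).
by case=> /=; [rewrite extend_y|rewrite extend_x].
Qed.

(** Composing with the automorphism [extend u v] keeps an element primitive and multiplies its pair
    by the matrix whose columns are the pairs of [u] and [v]. *)
Lemma primitive_pair_extend u v X Y :
    bijective (extend u v) -> primitive_pair X Y ->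
  primitive_pair (X * exp_sum false u + Y * exp_sum false v)%R
                 (X * exp_sum true u + Y * exp_sum true v)%R.
Proof.
move=> bij [_ [[f [f_bij <-]] [<- <-]]]; exists (extend u v (f x)); split.
  by exists (extend u v \o f); split; first exact: bij_comp.
by rewrite /exp_sum_pair 2!(exp_sum_morph _ (extend u v) (f x)) extend_x extend_y.
Qed.

Local Open Scope ring_scope.

Lemma primitive_pairD X Y : primitive_pair X Y -> primitive_pair X (X + Y).
Proof.
move=> /(@primitive_pair_extend (x * y)%g y).
rewrite !exp_sumM !exp_sum_gen /= addr0 add0r !mulr1 mulr0 addr0; apply.
(* The inverse of x |-> xy, y |-> y is x |-> xy^-1, y |-> y. *)
by exists (extend (x * y^-1)%g y); apply: extendK;
  rewrite ?gmulfM ?multiplicativeV extend_y // extend_x ?mulgK ?mulgVK.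
Qed.

Lemma primitive_pairC X Y : primitive_pair X Y -> primitive_pair Y X.
Proof.
move=> /(@primitive_pair_extend y x).
rewrite !exp_sum_gen /= !mulr1 !mulr0 addr0 add0r; apply.
by exists (extend y x); apply: extendK; rewrite ?extend_y ?extend_x.
Qed.

Lemma primitive_pairNl X Y : primitive_pair X Y -> primitive_pair (- X) Y.
Proof.
move=> /(@primitive_pair_extend x^-1%g y).
rewrite !exp_sumV !exp_sum_gen /= oppr0 !mulr1 !mulr0 addr0 add0r mulrN1; apply.
by exists (extend x^-1%g y); apply: extendK;
  rewrite ?multiplicativeV ?extend_y ?extend_x ?invgK.
Qed.

Lemma primitive_pair10 : primitive_pair 1 0.
Proof.
exists x; split; last by rewrite /exp_sum_pair !exp_sum_gen.
by exists idfun; split=> //; exists idfun.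
Qed.

(** Subtractive Euclidean algorithm, by induction on a bound for [m + n]. *)
Lemma primitive_pair_nat (m n : nat) :
  coprime m n -> primitive_pair m%:Z n%:Z.
Proof.
have [k] := ubnP (m + n)%N; elim: k m n => // k IHk m n.
wlog le_mn : m n / (m <= n)%N => [IH le_k co|].
  have [/IH|/ltnW/IH nm] := leqP m n; first exact.
  by apply: primitive_pairC; apply: nm; rewrite 1?addnC 1?coprime_sym.
case: m le_mn => [|m] le_mn le_k.
  by rewrite /coprime gcd0n => /eqP ->; apply/primitive_pairC/primitive_pair10.
(* Subtracting the smaller entry, now the positive [m.+1], from [n] keeps the gcd and strictly
   lowers the sum. *)
rewrite -(subnKC le_mn) {1}/coprime gcdnDl => co.
rewrite PoszD; apply/primitive_pairD/IHk => //; lia.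
Qed.

Lemma primitive_pair_coprimez X Y : coprimez X Y -> primitive_pair X Y.
Proof.
have absl A B : primitive_pair `|A|%N%:Z B -> primitive_pair A B.
  by case: A => // n /primitive_pairNl; rewrite NegzE.
(* Signs are removed one coordinate at a time, with a swap to reach the second. *)
move=> co; apply/absl/primitive_pairC/absl/primitive_pairC.
by apply: primitive_pair_nat; rewrite -coprimezE.
Qed.

Lemma coprimez_primitive_pair X Y : primitive_pair X Y -> coprimez X Y.
Proof.
move=> [_ [[f [[g fK gK] <-]] [<- <-]]].
pose gm : {multiplicative F2 -> F2} :=
  HB.pack g (isMultiplicative.Build F2 F2 g (can2_gmulfM fK gK)).
(* Since [gm (f x) = x] has exponent sum 1 in [x], the first row of the matrix of [gm] gives Bezout
   coefficients for the pair of [f x]. *)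
have := exp_sum_morph false gm (f x).
rewrite [gm _]fK exp_sum_gen /= => e; apply/coprimezP.
exists (exp_sum false (gm x), exp_sum false (gm y)).
by rewrite /= [RHS]e; ring.
Qed.

Local Close Scope ring_scope.

Theorem theorem4 (X Y : int) :
  (exists p : F2, primitive p /\ exp_sum_pair p = (X, Y)) <-> coprimez X Y.
Proof.
split; [exact: coprimez_primitive_pair | exact: primitive_pair_coprimez].
Qed.
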